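(* Let $I_R(x)=\int_0^\infty e^{-xt}\,\dfrac{dt}{t(\pi^2+\log^2 t)}$ for $x>0$, and let $I_R^{(n)}$ denote its $n$-th derivative on $(0,\infty)$. Then the following inequalities hold. (i) For $n=2m$ with $m=1,2,3,\dots$, $$I_R^{(n)}(x)+I_R^{(n)}(y)\le\frac{I_R^{(n)}(x)\,I_R^{(n)}(y)}{I_R^{(n)}(x+y)},\qquad x,y>0.$$ (ii) For $n=2m+1$ with $m=1,2,3,\dots$, $$I_R^{(n)}(x)+I_R^{(n)}(y)\ge\frac{I_R^{(n)}(x)\,I_R^{(n)}(y)}{I_R^{(n)}(x+y)},\qquad x,y>0.$$ (iii) For $n=2m$ with $m=1,2,3,\dots$, $$\beta I_R^{(n)}(\beta x)\ge I_R^{(n)}(x),\qquad x>0,\ \beta\in(0,1).$$ (iv) For $n=2m+1$ with $m=1,2,3,\dots$, $$\beta I_R^{(n)}(\beta x)\le I_R^{(n)}(x),\qquad x>0,\ \beta\in(0,1).$$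
   Context: $I_R$ is the Ramanujan integral, and $\log^2 t$ means $(\log t)^2$ with the natural logarithm. *)

(* Defs.v *)
From mathcomp Require Import all_boot all_order all_algebra.
From mathcomp Require Import all_classical all_reals all_analysis.

Set Implicit Arguments.
Unset Strict Implicit.
Unset Printing Implicit Defensive.

Import Order.TTheory GRing.Theory Num.Theory.
Import numFieldNormedType.Exports.

Local Open Scope ring_scope.
Local Open Scope classical_set_scope.

(* The Ramanujan integral, meaningful for [x > 0].  The integrand is
   nonnegative, so the Lebesgue integral over ]0, +oo[ agrees with the improper
   Riemann integral, which is finite for [x >= 0] since
   [dt / (t (pi^2 + ln^2 t))] has total mass 1.  For [x < 0] the integral
   diverges and [Rintegral] returns 0; this does not affect the derivatives at
   points of the open half-line [x > 0]. *)
Definition ramanujan_integral {R : realType} (x : R) : R :=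
  \int[@lebesgue_measure R]_(t in `]0, +oo[)
    (expR (- x * t) / (t * (pi ^+ 2 + ln t ^+ 2))).

(* The [n]-th derivative; [f^`(n)] parses as a polynomial derivative inside
   arithmetic expressions. *)
Notation dI_R n := (derive1n n ramanujan_integral).

(* Main.v *)
Require Import Defs.
From mathcomp Require Import all_boot all_order all_algebra.
From mathcomp Require Import all_classical all_reals all_analysis.
From mathcomp Require Import measurable_realfun ring lra.

Import Order.TTheory GRing.Theory Num.Theory.
Import numFieldNormedType.Exports.

Local Open Scope ring_scope.
Local Open Scope classical_set_scope.

(** Differentiating [n] times under the integral sign gives
    [I_R^(n) x = (-1)^n M_n x] with [M_n x = \int_0^oo e^(-x t) w_n t dt] and
    [w_n t = t^n / (t (pi^2 + ln^2 t))].  This is legitimate for [x > 0] because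
    the density [1 / (t (pi^2 + ln^2 t))] is integrable on [(0, oo)] (it has the
    bounded primitive [atan (ln t / pi) / pi]) while [t^n e^(-x t)] is bounded
    ([is_derive_ramanujan_moment], [derive1n_ramanujan_integral]).

    For [n >= 2] the weight [w_n] is nondecreasing ([ler_ramanujan_weight]), and
    this forces [x M_n x] to be nonincreasing ([ramanujan_moment_scale]): for
    [0 < b < 1] the difference [b M_n (b x) - M_n x] is the integral of [w_n]
    against the kernel [b e^(-b x t) - e^(-x t)], whose total integral is [0]
    and which is negative before some point [t0] and nonnegative after it, so
    that replacing [w_n] by the constant [w_n t0] can only decrease the integral.

    Since [M_n > 0], monotonicity of [x M_n x] makes [1 / M_n] superadditive
    ([inv_superadditive_of_scale]).  The four inequalities are these two facts,
    with the sign [(-1)^n] deciding the direction. *)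

Local Notation mu := lebesgue_measure.

(** The density [1 / (t (pi^2 + ln^2 t))]; only its values for [t > 0] matter. *)
Definition ramanujan_density {R : realType} (t : R) : R :=
  (t * (pi ^+ 2 + ln t ^+ 2))^-1.

(** [(-1)^n] times the [n]-th derivative of the Ramanujan integral at [x > 0]. *)
Definition ramanujan_moment {R : realType} (n : nat) (x : R) : R :=
  \int[@lebesgue_measure R]_(t in `]0, +oo[)
    (t ^+ n * expR (- x * t) * ramanujan_density t).

(** [t^n / (t (pi^2 + ln^2 t))], the function whose Laplace transform is
    [ramanujan_moment n]. *)
Definition ramanujan_weight {R : realType} (n : nat) (t : R) : R :=
  t ^+ n * ramanujan_density t.

Section density.
Context {R : realType}.
Implicit Types (t x : R) (n : nat).

(** * Integrability of the density *)

Lemma pi2Dln2_gt0 t : 0 < pi ^+ 2 + ln t ^+ 2.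
Proof. by rewrite ltr_pwDl ?sqr_ge0// exprn_gt0// pi_gt0. Qed.

Lemma ramanujan_density_gt0 t : 0 < t -> 0 < ramanujan_density t.
Proof. by move=> t0; rewrite invr_gt0 mulr_gt0// pi2Dln2_gt0. Qed.

Lemma is_derive_atan_ln t : 0 < t ->
  is_derive t 1 (fun s : R => atan (ln s * pi^-1) * pi^-1)
    (ramanujan_density t).
Proof.
move=> t0; have pi0 := @pi_gt0 R.
have h1 : is_derive t 1 (fun s : R => ln s * pi^-1) (t^-1 * pi^-1).
  have := is_derive1_ln t0 => h.
  apply: is_derive_eq.
  by rewrite scaler0 add0r/= /GRing.scale/= mulrC.
have h2 := @is_derive1_comp _ (@atan R) (fun s : R => ln s * pi^-1) t _ _
   (is_derive1_atan _) h1.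
have h3 := is_deriveM h2 (is_derive_cst (pi^-1 : R) t 1).
apply: (is_derive_eq h3); rewrite scaler0 add0r /GRing.scale/=.
rewrite /ramanujan_density; have := pi2Dln2_gt0 t.
move: (ln t) => l l0; clear h1 h2 h3.
by move: pi pi0 l0 => p p0 l0; field; rewrite !gt_eqF.
Qed.

Lemma ramanujan_density_continuous :
  {in `]0, +oo[%R, continuous (@ramanujan_density R)}.
Proof.
move=> t; rewrite in_itv/= andbT => t0.
apply: (@continuousV _ _ (fun t : R => t * (pi ^+ 2 + ln t ^+ 2))).
  by rewrite mulf_neq0 ?gt_eqF// pi2Dln2_gt0.
apply: (@continuousM _ _ (fun t : R => t) (fun t : R => (pi ^+ 2 + ln t ^+ 2))).
  exact: cvg_id.
apply: (@continuousD _ _ _ (fun t : R => pi ^+ 2) (fun t : R => ln t ^+ 2)).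
  exact: cst_continuous.
apply: (@continuous_comp _ _ _ (@ln R) (fun t : R => t ^+ 2)).
  exact: continuous_ln.
exact: exprn_continuous.
Qed.

Lemma measurable_ramanujan_density :
  measurable_fun (`]0, +oo[ : set R) (@ramanujan_density R).
Proof.
apply: open_continuous_measurable_fun; first exact: interval_open.
by move=> t; rewrite inE => /ramanujan_density_continuous.
Qed.

Lemma integral_ramanujan_density_le1 (a b : R) : 0 < a -> a < b ->
  (\int[mu]_(t in `[a, b]) (ramanujan_density t)%:E <= 1)%E.
Proof.
move=> a0 ab; have pi0 := @pi_gt0 R.
have sub (t : R) : `[a, b] t -> t \in `]0, +oo[%R.
  by rewrite /= !in_itv/= andbT => /andP[+ _]; exact: lt_le_trans.
pose P (s : R) := atan (ln s * pi^-1) * pi^-1.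
have dP (t : R) : a <= t -> is_derive t 1 P (ramanujan_density t).
  by move=> at_; apply: is_derive_atan_ln; exact: lt_le_trans at_.
have cP (t : R) : a <= t -> {for t, continuous P}.
  move=> at_; apply: differentiable_continuous; apply/derivable1_diffP.
  by have [] := dP _ at_.
rewrite (@continuous_FTC2 _ _ P)//.
- rewrite -EFinB lee_fin -mulrBl ler_pdivrMr// mul1r.
  have := atan_ltpi2 (ln b * pi^-1); have := atan_gtNpi2 (ln a * pi^-1).
  lra.
- apply: continuous_in_subspaceT => t; rewrite inE => /sub.
  exact: ramanujan_density_continuous.
- split.
  + by move=> t; rewrite in_itv/= => /andP[/ltW /dP[]].
  + by apply: cvg_at_right_filter; apply: cP.
  + by apply: cvg_at_left_filter; apply: cP; exact: ltW.
- move=> t; rewrite in_itv/= => /andP[/ltW /dP h _].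
  by rewrite derive1E; apply: derive_val.
Qed.

Lemma integrable_ramanujan_density :
  mu.-integrable (`]0, +oo[ : set R) (EFin \o @ramanujan_density R).
Proof.
have mg := measurable_ramanujan_density.
apply/integrableP; split; first exact/measurable_EFinP.
have -> : (\int[mu]_(t in (`]0%R, +oo[ : set R))
      `|(EFin \o ramanujan_density) t| =
    \int[mu]_(t in (`]0%R, +oo[ : set R)) (ramanujan_density t)%:E)%E.
  apply: eq_integral => t; rewrite inE/= in_itv/= andbT => t0.
  by rewrite ger0_norm// ltW// ramanujan_density_gt0.
(* The compact intervals [1/(n+2), n+2] exhaust the half-line; the shift by 2
   keeps each of them nondegenerate, and on each the integral is at most 1. *)
pose K (n : nat) : set R := `[n.+2%:R^-1, n.+2%:R].
have K0 n t : K n t -> 0 < t.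
  rewrite /K/= in_itv/= => /andP[h _]; apply: lt_le_trans h.
  by rewrite invr_gt0.
have UK : \bigcup_n K n = `]0, +oo[.
  apply/seteqP; split => t.
    by case=> n _ /K0; rewrite /= in_itv/= andbT.
  rewrite /= in_itv/= andbT => t0.
  have [n [ht hv]] : exists n : nat, t <= n%:R /\ t^-1 <= n%:R.
    exists (maxn (Num.bound t) (Num.bound t^-1)); split.
      apply: (le_trans (ltW (archi_boundP (ltW t0)))).
      by rewrite ler_nat leq_maxl.
    apply: le_trans (ltW (archi_boundP _)) _; first by rewrite invr_ge0 ltW.
    by rewrite ler_nat leq_maxr.
  exists n => //; rewrite /K/= in_itv/=.
  have nn : (n%:R : R) <= n.+2%:R by rewrite ler_nat !leqW.
  rewrite (le_trans ht nn) andbT invf_ple ?posrE//.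
  exact: le_trans hv nn.
have mK n : measurable (K n) by exact: measurable_itv.
have ndK : nondecreasing_seq K.
  move=> m n mn; rewrite subsetEset; apply: subset_itv; rewrite bnd_simp.
    by rewrite lef_pV2 ?posrE// ler_nat.
  by rewrite ler_nat.
have mgK n : measurable_fun (K n) (EFin \o @ramanujan_density R).
  apply/measurable_EFinP; apply: measurable_funS mg => //.
  by move=> t /K0; rewrite /= in_itv/= andbT.
have gK n t : K n t -> (0 <= (EFin \o @ramanujan_density R) t)%E.
  by move=> /K0 t0; rewrite lee_fin ltW// ramanujan_density_gt0.
have cvK : (\int[mu]_(t in K n) (ramanujan_density t)%:E @[n --> \oo] -->
    \int[mu]_(t in (`]0%R, +oo[ : set R)) (ramanujan_density t)%:E)%E.
  by rewrite -UK; exact: ge0_nondecreasing_set_cvg_integral.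
rewrite -(cvg_lim _ cvK)//.
apply: (@le_lt_trans _ _ 1%E); last exact: ltry.
apply: lime_le; first exact: cvgP cvK.
apply: nearW => n; apply: integral_ramanujan_density_le1.
  by rewrite invr_gt0.
by rewrite (@lt_trans _ _ 1)// ?invf_lt1 ?ltr1n.
Qed.

(** * Differentiation under the integral sign *)

Lemma ler_exprn_expR n x t : 0 < x -> 0 <= t ->
  t ^+ n * expR (- x * t) <= n`!%:R / x ^+ n.
Proof.
move=> x0 t0; have xt0 : 0 <= x * t by rewrite mulr_ge0// ltW.
rewrite mulNr expRN ler_pdivrMr ?expR_gt0// mulrAC ler_pdivlMr ?exprn_gt0//.
rewrite -exprMn (mulrC t) -ler_pdivrMl ?ltr0n ?fact_gt0// [leLHS]mulrC.
case: n => [|n]; first by rewrite expr0 fact0 divr1 -[leLHS]expR0 ler_expR.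
by apply: le_trans (expR_ge1Dxn n xt0); rewrite lerDr.
Qed.

Lemma integrable_ramanujan_moment n x : 0 < x ->
  mu.-integrable (`]0, +oo[ : set R)
    (EFin \o (fun t : R => t ^+ n * expR (- x * t) * ramanujan_density t)).
Proof.
move=> x0.
apply: le_integrable (integrableZl _ (n`!%:R / x ^+ n)
  integrable_ramanujan_density) => //.
- apply/measurable_EFinP; apply: measurable_funM; last first.
    exact: measurable_ramanujan_density.
  apply: measurable_funM; first exact: measurable_funX.
  apply: measurableT_comp => //; exact: measurable_funM.
- move=> t; rewrite /= in_itv/= andbT => t0.
  have g0 := ramanujan_density_gt0 t t0.
  rewrite lee_fin normrM [leRHS]normrM (ger0_norm (ltW g0)) ler_pM2r//.
  rewrite [leLHS]ger0_norm ?mulr_ge0 ?expR_ge0 ?exprn_ge0 ?(ltW t0)//.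
  by apply: le_trans (ler_norm _); exact: ler_exprn_expR (ltW t0).
Qed.

Lemma is_derive_ramanujan_moment n x : 0 < x ->
  is_derive x 1 (@ramanujan_moment R n) (- ramanujan_moment n.+1 x).
Proof.
move=> x0.
pose f (y t : R) := t ^+ n * expR (- y * t) * ramanujan_density t.
have df (y t : R) : is_derive y 1 (f ^~ t)
    (- (t ^+ n.+1 * expR (- y * t) * ramanujan_density t)).
  have h : is_derive y 1 (fun y : R => - y * t) (- t).
    apply: is_derive_eq; rewrite scaler0 add0r /GRing.scale/=; ring.
  have h2 := @is_derive1_comp _ expR (fun y : R => - y * t) y _ _
    (is_derive_expR _) h.
  have h3 := is_deriveM (is_derive_cst (t ^+ n : R) y 1) h2.
  have h4 := is_deriveM h3 (is_derive_cst (ramanujan_density t : R) y 1).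
  apply: (is_derive_eq h4).
  rewrite !scaler0 /GRing.scale/= exprS; ring.
have d1f (y t : R) : partial1of2 f y t =
    - (t ^+ n.+1 * expR (- y * t) * ramanujan_density t).
  by rewrite partial1of2E; apply: derive_val.
(* On the neighbourhood (x/2, 2x) of x, the derivative of the integrand is
   dominated by its absolute value at the left end. *)
have xI : `]x / 2, x * 2[ x.
  rewrite /= in_itv/= ltr_pdivrMr// ltr_pMr//; lra.
have yI (y : R) : `]x / 2, x * 2[ y -> x / 2 < y.
  by rewrite /= in_itv/= => /andP[].
pose G t : R := `|t ^+ n.+1 * expR (- (x / 2) * t) * ramanujan_density t|.
have iG : mu.-integrable (`]0, +oo[ : set R) (EFin \o G).
  apply: integrable_norm; apply: integrable_ramanujan_moment; lra.
have if_ (y : R) : `]x / 2, x * 2[ y ->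
    mu.-integrable (`]0, +oo[ : set R) (EFin \o f y).
  move=> /yI y0; apply: integrable_ramanujan_moment; lra.
have df' (y t : R) : `]x / 2, x * 2[ y -> (`]0, +oo[ : set R) t ->
  derivable (f ^~ t) y 1 by move=> _ _; have [] := df y t.
have ubG (y t : R) : `]x / 2, x * 2[ y -> (`]0, +oo[ : set R) t ->
    `|partial1of2 f y t| <= G t.
  move=> /yI yx; rewrite /= in_itv/= andbT => t0.
  rewrite d1f /G normrN !normrM !ler_wpM2r// ler_wpM2l//.
  rewrite !ger0_norm ?expR_ge0// ler_expR !mulNr lerN2 ler_pM2r//.
  exact: ltW.
have G0 (t : R) : 0 <= G t by exact: normr_ge0.
apply: DeriveDef.
  by apply: (derivable_under_integral _ xI if_ df' G0 iG ubG).
rewrite -derive1E.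
transitivity (\int[mu]_(t in (`]0, +oo[ : set R)) (partial1of2 f x t)).
  by apply: (differentiation_under_integral _ xI if_ df' G0 iG ubG).
under eq_Rintegral do rewrite d1f -mulN1r.
rewrite RintegralZl// ?mulN1r//.
exact: integrable_ramanujan_moment.
Qed.

Lemma derive1n_ramanujan_integral n x : 0 < x ->
  dI_R n x = (-1) ^+ n * ramanujan_moment n x.
Proof.
elim: n x => [|n IH] x x0.
  rewrite derive1n0 mul1r /ramanujan_integral /ramanujan_moment.
  by apply: eq_Rintegral => t _; rewrite expr0 mul1r.
rewrite derive1nS derive1E.
rewrite (@near_eq_derive _ _ _ _
  ((-1) ^+ n \*: (@ramanujan_moment R n)))//; last first.
  by near=> y; apply: IH; near: y; exact: lt_nbhsr.
have h := is_derive_ramanujan_moment n x x0.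
rewrite deriveZ// derive_val /GRing.scale/= exprS; ring.
Unshelve. end_near. Qed.

(** * Monotonicity of the weight and the scaling inequality *)

Lemma expR_half_line x : 0 < x ->
  mu.-integrable (`]0, +oo[ : set R) (EFin \o (fun t : R => expR (- x * t))) /\
  \int[mu]_(t in (`]0, +oo[ : set R)) expR (- x * t) = x^-1.
Proof.
move=> x0.
have me (D : set R) : measurable_fun D (fun t : R => expR (- x * t)).
  apply: measurable_funTS.
  apply: measurableT_comp => //; exact: measurable_funM.
have E : (\int[mu]_(t in (`]0%R, +oo[ : set R)) (expR (- x * t))%:E = x^-1%:E)%E.
  rewrite integral_itv_obnd_cbnd; last exact/measurable_EFinP.
  have : (\int[mu]_(t in (`[0%R, +oo[ : set R)) (x * expR (- x * t))%:E = 1)%E.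
    by rewrite integral_mkcond restrict_EFin; exact: integral_exponential_pdf.
  under eq_integral do rewrite EFinM.
  rewrite ge0_integralZl//; last 2 first.
  - by apply/measurable_EFinP; exact: me.
  - by rewrite lee_fin ltW.
  move=> h; rewrite -[LHS]mul1e (_ : 1%E = (x^-1 * x)%:E); last first.
    by rewrite mulVf ?gt_eqF.
  by rewrite EFinM -muleA h mule1.
split; last by rewrite /Rintegral E.
apply/integrableP; split; first by apply/measurable_EFinP; exact: me.
apply: (@le_lt_trans _ _ x^-1%:E); last exact: ltry.
rewrite -E le_eqVlt; apply/orP; left; apply/eqP.
by apply: eq_integral => t _; rewrite /= ger0_norm// expR_ge0.
Qed.

(** It suffices to treat [t / (pi^2 + ln^2 t)], the remaining factor being a
    power of [t].  With [a = ln s] and [d = ln t - ln s >= 0] the claim becomes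
    [pi^2 + (a + d)^2 <= e^d (pi^2 + a^2)]. *)
Lemma ler_ramanujan_weight n s t : (1 < n)%N -> 0 < s -> s <= t ->
  ramanujan_weight n s <= ramanujan_weight n t.
Proof.
case: n => [|[|n]]// _ s0 st; have t0 := lt_le_trans s0 st.
rewrite /ramanujan_weight /ramanujan_density.
have E (u : R) : 0 < u -> u ^+ n.+2 * (u * (pi ^+ 2 + ln u ^+ 2))^-1 =
    u ^+ n * (u / (pi ^+ 2 + ln u ^+ 2)).
  move=> u0; rewrite 2!exprS; have := pi2Dln2_gt0 u.
  move: (u ^+ n) (pi ^+ 2 + _) => w p p0; field.
  by rewrite !gt_eqF.
rewrite !E//; apply: ler_pM.
- by rewrite exprn_ge0// ltW.
- by rewrite divr_ge0// ltW// pi2Dln2_gt0.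
- by rewrite lerXn2r// nnegrE ltW.
rewrite ler_pdivrMr ?pi2Dln2_gt0// mulrAC ler_pdivlMr ?pi2Dln2_gt0//.
set a := ln s; set d := ln t - a.
have d0 : 0 <= d by rewrite subr_ge0 ler_ln ?posrE.
have -> : t = s * expR d.
  by rewrite expRD expRN !lnK ?posrE// mulrCA divff ?mulr1// gt_eqF.
rewrite -mulrA ler_pM2l//.
have -> : ln (s * expR d) = a + d by rewrite lnM ?posrE ?expR_gt0// expRK.
(* Squaring e^(d/2) >= 1 + d/2 yields the quadratic lower bound on e^d; with
   pi^2 >= 4 what is left is a polynomial inequality. *)
have ed : (1 + d / 2) ^+ 2 <= expR d.
  rewrite [in leRHS](_ : d = d / 2 + d / 2); last by field.
  rewrite expRD -expr2 lerXn2r ?nnegrE ?expR_ge0 ?expR_ge1Dx//.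
  by rewrite addr_ge0// divr_ge0.
have p4 : 4 <= (pi : R) ^+ 2.
  by have := pi_ge2 R; move: pi => p; nra.
apply: (@le_trans _ _ ((1 + d / 2) ^+ 2 * (pi ^+ 2 + a ^+ 2))); last first.
  by rewrite ler_wpM2r// addr_ge0 ?sqr_ge0// (le_trans _ p4).
clearbody a d.
move: (pi ^+ 2) p4 => p p4.
have h1 : 0 <= d * (p - 4) by rewrite mulr_ge0// subr_ge0.
have h2 : 0 <= d * (a - 1) ^+ 2 by rewrite mulr_ge0 ?sqr_ge0.
have h3 : 0 <= d ^+ 2 * (p - 4) by rewrite mulr_ge0 ?sqr_ge0 ?subr_ge0.
have h4 : 0 <= d ^+ 2 * a ^+ 2 by rewrite mulr_ge0 ?sqr_ge0.
nra.
Qed.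

Lemma ramanujan_momentE n x : ramanujan_moment n x =
  \int[mu]_(t in (`]0, +oo[ : set R)) (expR (- x * t) * ramanujan_weight n t).
Proof. by apply: eq_Rintegral => t _; rewrite /ramanujan_weight; ring. Qed.

Lemma integrable_ramanujan_weight n x : 0 < x ->
  mu.-integrable (`]0, +oo[ : set R)
    (EFin \o (fun t : R => expR (- x * t) * ramanujan_weight n t)).
Proof.
move=> x0; apply: eq_integrable (integrable_ramanujan_moment n _ x0) => //.
by move=> t _ /=; congr EFin; rewrite /ramanujan_weight; ring.
Qed.

(** Equivalently, [x * ramanujan_moment n x] is nonincreasing in [x]. *)
Lemma ramanujan_moment_scale n x b : (1 < n)%N -> 0 < x -> 0 < b < 1 ->
  ramanujan_moment n x <= b * ramanujan_moment n (b * x).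
Proof.
move=> n1 x0 /andP[b0 b1]; have bx0 : 0 < b * x by rewrite mulr_gt0.
have iw := integrable_ramanujan_weight n _ x0.
have ibw := integrable_ramanujan_weight n _ bx0.
have [ie E] := expR_half_line _ x0.
have [ibe Eb] := expR_half_line _ bx0.
have mD : measurable (`]0, +oo[ : set R) by exact: measurable_itv.
pose k (t : R) := b * expR (- (b * x) * t) - expR (- x * t).
(* The kernel changes sign, from negative to nonnegative, at t0. *)
pose t0 := - ln b / ((1 - b) * x).
have lnb : 0 < - ln b by rewrite oppr_gt0 ln_lt0// b0.
have bx1 : 0 < (1 - b) * x by rewrite mulr_gt0// subr_gt0.
have t00 : 0 < t0 by rewrite divr_gt0.
pose w := @ramanujan_weight R n.
have kw (t : R) : 0 < t -> k t * w t0 <= k t * w t.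
  move=> tp; rewrite -subr_ge0 -mulrBr.
  have kE : (0 <= k t) = (t0 <= t).
    have -> : k t = expR (ln b - b * x * t) - expR (- x * t).
      by rewrite /k expRD lnK ?posrE// mulNr.
    rewrite subr_ge0 ler_expR.
    by rewrite /t0 ler_pdivrMr//; apply/idP/idP; lra.
  have [tt|tt] := leP t0 t.
    by rewrite mulr_ge0 ?kE// subr_ge0 ler_ramanujan_weight.
  apply: mulr_le0; first by rewrite ltW// ltNge kE -ltNge.
  by rewrite subr_le0 ler_ramanujan_weight// ltW.
have ik : mu.-integrable (`]0, +oo[ : set R) (EFin \o k).
  by apply: (integrableB _ (integrableZl _ b ibe) ie).
have ikw0 : mu.-integrable (`]0, +oo[ : set R) (EFin \o (fun t => k t * w t0)).
  apply: eq_integrable (integrableZl _ (w t0) ik) => //.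
  by move=> t _ /=; rewrite -EFinM mulrC.
have ibbw : mu.-integrable (`]0, +oo[ : set R)
    (EFin \o (fun t => b * (expR (- (b * x) * t) * ramanujan_weight n t))).
  by apply: (integrableZl _ b ibw).
have ikw : mu.-integrable (`]0, +oo[ : set R) (EFin \o (fun t => k t * w t)).
  apply: eq_integrable (integrableB _ ibbw iw) => //.
  by move=> t _ /=; rewrite -EFinB; congr EFin; rewrite /k/w; ring.
have k0 : \int[mu]_(t in (`]0, +oo[ : set R)) (k t * w t0) = 0.
  rewrite RintegralZr// RintegralB//; last by apply: (integrableZl _ b ibe).
  rewrite RintegralZl// Eb E (_ : b * (b * x)^-1 = x^-1) ?subrr ?mul0r//.
  by field; rewrite !gt_eqF.
rewrite -subr_ge0.
suff -> : b * ramanujan_moment n (b * x) - ramanujan_moment n x =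
    \int[mu]_(t in (`]0, +oo[ : set R)) (k t * w t).
  rewrite -[leLHS]k0; apply: (le_Rintegral _ ikw0 ikw) => // t.
  by rewrite /= in_itv/= andbT; exact: kw.
transitivity (\int[mu]_(t in (`]0, +oo[ : set R))
    (b * (expR (- (b * x) * t) * w t) - expR (- x * t) * w t)).
  rewrite !ramanujan_momentE.
  apply: etrans (esym (RintegralB _ ibbw iw)) => //; congr (_ - _).
  exact: esym (RintegralZl _ _ ibw).
by apply: eq_Rintegral => t _; rewrite /k mulrBl mulrA.
Qed.

Lemma ramanujan_weight_ge0 n t : 0 < t -> 0 <= ramanujan_weight n t.
Proof.
by move=> t0; rewrite mulr_ge0 ?exprn_ge0 ?(ltW t0)// ltW ?ramanujan_density_gt0.
Qed.

Lemma ramanujan_moment_gt0 n x : (1 < n)%N -> 0 < x -> 0 < ramanujan_moment n x.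
Proof.
move=> n1 x0; have iw := integrable_ramanujan_weight n _ x0.
have sub : `[1%R, 2%R] `<=` (`]0, +oo[ : set R).
  by move=> t /=; rewrite !in_itv/= andbT => /andP[+ _]; exact: lt_le_trans.
(* On [1, 2] the integrand is at least c: the exponential is smallest at 2 and
   the weight at 1. *)
pose c : R := expR (- x * 2) * ramanujan_weight n 1.
have c0 : 0 < c.
  by rewrite mulr_gt0 ?expR_gt0// mulr_gt0 ?exprn_gt0 ?ramanujan_density_gt0.
have lb : (c%:E <= \int[mu]_(t in (`]0%R, +oo[ : set R))
    (expR (- x * t) * ramanujan_weight n t)%:E)%E.
  apply: (@le_trans _ _ (\int[mu]_(t in (`[1%R, 2%R] : set R))
    (expR (- x * t) * ramanujan_weight n t)%:E)%E); last first.
    apply: ge0_subset_integral => //.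
      by case/integrableP: iw.
    move=> t; rewrite /= in_itv/= andbT => t0.
    by rewrite lee_fin mulr_ge0 ?expR_ge0 ?ramanujan_weight_ge0.
  have -> : (c%:E = \int[mu]_(t in (`[1%R, 2%R] : set R)) c%:E)%E.
    rewrite integral_cst//= lebesgue_measure_itv/= lte_fin ltr1n.
    by rewrite -EFinB -EFinM; congr EFin; ring.
  apply: ge0_le_integral => //.
  - by move=> t _; rewrite lee_fin ltW.
  - by case/integrableP: iw => mw _; exact: measurable_funS mw.
  move=> t; rewrite /= in_itv/= => /andP[t1 t2].
  rewrite lee_fin ler_pM ?expR_ge0 ?ramanujan_weight_ge0 ?ler_ramanujan_weight//.
  by rewrite ler_expR !mulNr lerN2 ler_pM2l.
rewrite ramanujan_momentE (lt_le_trans c0)// -lee_fin /Rintegral fineK//.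
by apply: integrable_fin_num iw.
Qed.

End density.

(** * Superadditivity of the reciprocal *)

(** The scaling hypothesis says that [x * F x] is nonincreasing, i.e. that
    [1 / F] is [x] times a nondecreasing function.  The conclusion is
    [1 / F x + 1 / F y <= 1 / F (x + y)], cleared of denominators. *)
Lemma inv_superadditive_of_scale {R : realFieldType} (F : R -> R) :
  (forall x, 0 < x -> 0 < F x) ->
  (forall x b, 0 < x -> 0 < b < 1 -> F x <= b * F (b * x)) ->
  forall x y, 0 < x -> 0 < y -> F x + F y <= F x * F y / F (x + y).
Proof.
move=> F0 Fscale x y x0 y0; have s0 : 0 < x + y by rewrite addr_gt0.
have h (u v : R) : 0 < u -> 0 < v -> F (u + v) <= u / (u + v) * F u.
  move=> u0 v0; have uv : 0 < u + v by rewrite addr_gt0.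
  have -> : F u = F (u / (u + v) * (u + v)) by rewrite divfK// gt_eqF.
  apply: Fscale => //.
  by rewrite divr_gt0//= ltr_pdivrMr// mul1r ltrDl.
rewrite ler_pdivlMr ?F0// mulrDl.
have hx := ler_wpM2l (ltW (F0 y y0)) (h _ _ x0 y0).
have hy := ler_wpM2l (ltW (F0 x x0)) (h _ _ y0 x0).
apply: (@le_trans _ _ (F x * (y / (y + x) * F y) + F y * (x / (x + y) * F x))).
  by rewrite lerD// addrC.
rewrite le_eqVlt; apply/orP; left; apply/eqP; field.
by rewrite !gt_eqF// addrC.
Qed.

Theorem theorem6 (R : realType) :
  [/\ (forall m n : nat, (1 <= m)%N -> n = (2 * m)%N ->
        forall x y : R, 0 < x -> 0 < y ->
          dI_R n x + dI_R n y <= dI_R n x * dI_R n y / dI_R n (x + y)),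
      (forall m n : nat, (1 <= m)%N -> n = (2 * m + 1)%N ->
        forall x y : R, 0 < x -> 0 < y ->
          dI_R n x + dI_R n y >= dI_R n x * dI_R n y / dI_R n (x + y)),
      (forall m n : nat, (1 <= m)%N -> n = (2 * m)%N ->
        forall x beta : R, 0 < x -> 0 < beta < 1 ->
          beta * dI_R n (beta * x) >= dI_R n x)
    & (forall m n : nat, (1 <= m)%N -> n = (2 * m + 1)%N ->
        forall x beta : R, 0 < x -> 0 < beta < 1 ->
          beta * dI_R n (beta * x) <= dI_R n x)].
Proof.
have dI_even (n m : nat) (x : R) : n = (2 * m)%N -> 0 < x ->
    dI_R n x = ramanujan_moment n x.
  move=> -> x0; rewrite derive1n_ramanujan_integral//.
  by rewrite exprM sqrrN !expr1n mul1r.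
have dI_odd (n m : nat) (x : R) : n = (2 * m + 1)%N -> 0 < x ->
    dI_R n x = - ramanujan_moment n x.
  move=> -> x0; rewrite derive1n_ramanujan_integral//.
  by rewrite exprD exprM sqrrN !expr1n mul1r expr1 mulN1r.
have super (n : nat) : (1 < n)%N -> forall x y : R, 0 < x -> 0 < y ->
    ramanujan_moment n x + ramanujan_moment n y <=
    ramanujan_moment n x * ramanujan_moment n y / ramanujan_moment n (x + y).
  move=> n1; apply: inv_superadditive_of_scale.
    by move=> x; exact: ramanujan_moment_gt0.
  by move=> x b; exact: ramanujan_moment_scale.
have lt1 (m : nat) : (1 <= m)%N -> (1 < 2 * m)%N.
  by case: m => // m _; rewrite mulnS.
split=> m n m1 nE.
- move=> x y x0 y0; rewrite !(dI_even n m)// ?addr_gt0//.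
  by apply: super; rewrite // nE lt1.
- move=> x y x0 y0; rewrite !(dI_odd n m)// ?addr_gt0//.
  rewrite mulrNN invrN mulrN -opprD lerN2.
  by apply: super; rewrite // nE ltn_addr// lt1.
- move=> x b x0 /andP[b0 b1]; rewrite !(dI_even n m)// ?mulr_gt0//.
  by apply: ramanujan_moment_scale; rewrite ?b0// nE lt1.
- move=> x b x0 /andP[b0 b1]; rewrite !(dI_odd n m)// ?mulr_gt0//.
  rewrite mulrN lerN2.
  by apply: ramanujan_moment_scale; rewrite ?b0// nE ltn_addr// lt1.
Qed.
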